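(* Let $d\ge 2$ be an integer and let $\gamma(t) = (t,t^2,\dots,t^d)$ parametrize the moment curve in $\mathbb{R}^d$. For all choices of real coefficients $a_n, A_n$ ($n\in\mathbb{Z}$) with $|a_n|\le A_n$ for all $n$, $$\Big\| \sum_{n \in \mathbb{Z}} a_ne(\gamma(n) \cdot x) \Big\|_{L^p([0,1]^d)} \leq (d!)^{1/(2d)}\Big\| \sum_{n \in \mathbb{Z}} A_ne(\gamma(n) \cdot x) \Big\|_{L^p([0,1]^d)}$$ for all $2 \leq p \leq 2d$.
   Context: Notation: $e(\theta) := e^{2\pi i \theta}$ for $\theta\in\mathbb{R}$; $\|f\|_{L^p([0,1]^d)} := \big(\int_{[0,1]^d}|f(x)|^p\,dx\big)^{1/p}$. *)

(* Defs.v *)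
From HB Require Import structures.
From mathcomp Require Import all_boot all_order all_algebra.
From mathcomp Require Import complex.
From mathcomp Require Import all_classical all_reals all_analysis.

Set Implicit Arguments.
Unset Strict Implicit.
Unset Printing Implicit Defensive.

Import Order.TTheory GRing.Theory Num.Theory.
Import numFieldNormedType.Exports.

Local Open Scope classical_set_scope.
Local Open Scope ring_scope.

Section unit_cube.
Context {R : realType}.

Definition unit_interval_measure : set (measurableTypeR R) -> \bar R :=
  mrestr lebesgue_measure (measurable_itv `[0 : R, 1 : R]).

HB.instance Definition _ := Measure.on unit_interval_measure.

Let unit_interval_measure_setT : unit_interval_measure setT = 1%E.
Proof.
rewrite /unit_interval_measure /mrestr setTI lebesgue_measure_itv /=.
by rewrite lte_fin ltr01 oppr0 adde0.
Qed.

HB.instance Definition _ := Measure_isProbability.Build _ _ R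
  unit_interval_measure unit_interval_measure_setT.

Definition tuple_cons n
    (z : measurableTypeR R * n.-tuple (measurableTypeR R)) :
  n.+1.-tuple (measurableTypeR R) := [tuple of z.1 :: z.2].

Lemma measurable_tuple_cons n : measurable_fun setT (@tuple_cons n).
Proof. exact: measurable_cons. Qed.

HB.instance Definition _ n :=
  isMeasurableFun.Build _ _ _ _ (@tuple_cons n) (@measurable_tuple_cons n).

(* The d-fold product of Lebesgue measure on [0,1]: Lebesgue measure on R^d    *)
(* restricted to [0,1]^d, see unit_cube_measure_box.                            *)
Fixpoint unit_cube_measure d : probability (d.-tuple (measurableTypeR R)) R :=
  if d is n.+1 then
    distribution (unit_interval_measure \x unit_cube_measure n)%E (@tuple_cons n)
  else \d_([tuple] : 0.-tuple (measurableTypeR R)).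


Lemma unit_cube_measure_box d (A : 'I_d -> set (measurableTypeR R)) :
  (forall i, measurable (A i)) ->
  unit_cube_measure d [set x | forall i, A i (tnth x i)] =
  (\prod_(i < d) unit_interval_measure (A i))%E.
Proof.
elim: d A => [|d IHd] A mA.
  rewrite big_ord0 /= diracE mem_set//= => -[]//.
pose B := [set x : d.-tuple (measurableTypeR R) |
             forall i, A (lift ord0 i) (tnth x i)].
have mB : measurable B.
  have -> : B = \bigcap_(i in [set: 'I_d])
      ((fun x : d.-tuple (measurableTypeR R) => tnth x i) @^-1`
        A (lift ord0 i)).
    by apply/seteqP; split => x /= Bx i; [move=> _|]; exact: Bx.
  apply: fin_bigcap_measurable => // i _.
  rewrite -[X in measurable X]setTI.
  exact: (measurable_tnth i).
rewrite big_ord_recl -IHd//= -/B /distribution /pushforward.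
rewrite -(product_measure1E _ _ (mA ord0) mB); congr (_ _).
apply/seteqP; split => -[s x] /= H.
  split; first by have := H ord0; rewrite (tnth_nth s).
  by move=> i; have := H (lift ord0 i); rewrite !(tnth_nth s).
move=> i; case: (unliftP ord0 i) => [j|] ->.
  by case: H => _ /(_ j); rewrite !(tnth_nth s).
by case: H; rewrite (tnth_nth s).
Qed.

End unit_cube.

Section exponential_sums.
Context {R : realType}.

Definition e (theta : R) : R[i] :=
  (cos (2 * pi * theta) +i* sin (2 * pi * theta))%C.

Definition moment_curve d (t : R) : d.-tuple R := [tuple t ^+ j.+1 | j < d].

Definition dotprod d (u v : d.-tuple R) : R := \sum_(j < d) tnth u j * tnth v j.

(* \sum_(-N <= n <= N) a n e(gamma(n) . x), with n = k - N *)
Definition expsum_partial d (a : int -> R) (N : nat)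
    (x : d.-tuple (measurableTypeR R)) : R[i] :=
  \sum_(0 <= k < N.*2.+1) (a (k%:Z - N%:Z))%:C%C *
    e (dotprod (moment_curve d (k%:Z - N%:Z)%:~R) x).

(* ||f||_{L^p([0,1]^d)}, possibly +oo *)
Definition Lnorm_cube d (p : R) (f : d.-tuple (measurableTypeR R) -> R[i]) :
    \bar R :=
  Lnorm (unit_cube_measure d) p%:E (fun x => (ComplexField.Normc.normc (f x))%:E).

(* F is the sum over n in Z of a_n e(gamma(n) . x) in the L^2 sense. The        *)
(* exponentials are orthonormal in L^2([0,1]^d), so a sum exists iff (a_n) is   *)
(* square-summable, it does not depend on the order of summation, and it is    *)
(* unique up to a null set; for finitely supported a it is the trigonometric   *)
(* polynomial itself. For p >= 2, convergence in L^p([0,1]^d) implies it.       *)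
Definition is_expsum d (a : int -> R)
    (F : d.-tuple (measurableTypeR R) -> R[i]) : Prop :=
  [/\ measurable_fun setT (fun x => complex.Re (F x)),
      measurable_fun setT (fun x => complex.Im (F x)) &
      Lnorm_cube 2 (fun x => F x - expsum_partial a N x) @[N --> \oo] --> 0%E].

End exponential_sums.

(* Main.v *)
Require Import Defs.
From HB Require Import structures.
From mathcomp Require Import all_boot all_order all_algebra all_fingroup.
From mathcomp Require Import complex zify ring lra.
From mathcomp Require Import all_classical all_reals all_analysis.
From mathcomp Require Import measurable_realfun.
Set Implicit Arguments.
Unset Strict Implicit.
Unset Printing Implicit Defensive.
Import Order.TTheory GRing.Theory Num.Theory.
Import numFieldNormedType.Exports.
Local Open Scope classical_set_scope.
Local Open Scope ring_scope.

(* On the probability space [0,1]^d the L^p norms increase with p, so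
   |F|_p <= |F|_2d <= (d!)^(1/2d) |a|_l2 <= (d!)^(1/2d) |A|_l2
   = (d!)^(1/2d) |G|_2 <= (d!)^(1/2d) |G|_p.
   The second inequality is the only one specific to the moment curve. Expanding
   F^d over d-tuples of frequencies, orthogonality makes two tuples s, t
   interact only if their first d power sums agree, i.e. (Newton) if t is a
   permutation of s, and each s has at most d! permutations. For infinite sums
   it passes to the limit by Fatou along an a.e. convergent subsequence of
   the partial sums. *)

(** The sum with coefficients a is not assumed to exist. Since the squared-coefficient sums of a
    grow no faster than those of A, square-summability passes from A to a, and F is then produced by
    a Riesz-Fischer construction. Convergence is available only in L^2, so the bound at exponent 2d
    cannot be passed to F by continuity of the norm. Fatou gives lower semicontinuity, which
    suffices because this norm stands on the small side. On the side of G, Bessel's inequality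
    bounds the partial sums of A_n^2 by the integral of |G|^2. The exponent 2d is special because
    |f|^(2d) = |f^d|^2: the L^2 norm of a d-th power is computed by orthogonality, and its
    frequencies record d power sums of d integers, just as many as Newton's identities need to
    recover a multiset of size d. The signs of the coefficients do no harm: each product of weights
    of two interacting tuples is at most half the sum of their squares, and what remains is a count
    of rearrangements. *)

Local Notation normc := ComplexField.Normc.normc.

(** * Tuples with equal power sums *)

Section power_sums.
Context {F : numFieldType}.
Implicit Types (x : F) (s t : seq F) (n : nat).

(** The reversal of the monic polynomial with roots s. Its constant coefficient is 1, which suits
    power series arguments, but zero entries of s leave no trace in it. *)
Definition revprod s : {poly F} := \prod_(x <- s) (1 - x *: 'X).
Definition psum_poly s n : {poly F} := \poly_(k < n) \sum_(x <- s) x ^+ k.+1.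

(* Newton's identities: with P = revprod s, P' / P = - \sum_k p_(k+1) X^k as power series. *)
Lemma revprod_log_deriv s n :
  'X^n %| (revprod s)^`() + revprod s * psum_poly s n.
Proof.
elim: s => [|x s IH].
  rewrite /revprod big_nil derivC add0r mul1r /psum_poly.
  by rewrite (_ : \poly_(k < n) _ = 0) ?dvdp0//; apply/polyP => k;
    rewrite coef_poly big_nil coef0 if_same.
(* A new entry x contributes the truncation of the geometric series x / (1 - x X). *)
have -> : psum_poly (x :: s) n
    = psum_poly s n + x%:P * \sum_(k < n) (x *: 'X) ^+ k.
  apply/polyP => k; rewrite coefD coefCM coef_sum !coef_poly.
  under [X in x * X]eq_bigr do rewrite exprZn coefZ coefXn.
  case: ifP => [kn|/negbT]; last first.
    rewrite -leqNgt => nk; rewrite add0r big1 ?mulr0// => i _.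
    by rewrite gtn_eqF ?mulr0// (leq_trans _ nk).
  rewrite big_cons addrC (bigD1 (Ordinal kn))//= eqxx mulr1 [X in x * (_ + X)]big1.
    by rewrite addr0 exprS.
  by move=> i /eqP ik; rewrite (_ : (k == i) = false) ?mulr0//;
    apply/eqP => ki; apply: ik; apply: val_inj.
have -> : revprod (x :: s) = (1 - x *: 'X) * revprod s.
  by rewrite /revprod big_cons.
set P := revprod s in IH *; set S := psum_poly s n in IH *.
have := subrX1 (x *: 'X) n; set g := \sum_(k < n) _ => xg.
(* The factor 1 - x X telescopes the geometric sum; only the cut-off term, a multiple of X^n, is
   left over. *)
have -> : ((1 - x *: 'X) * P)^`() + (1 - x *: 'X) * P * (S + x%:P * g) =
   (1 - x *: 'X) * (P^`() + P * S) - (x ^+ n.+1 *: P) * 'X^n.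
  rewrite derivM derivB derivC derivZ derivX sub0r.
  transitivity ((1 - x *: 'X) * (P^`() + P * S) - x%:P * P
    - x%:P * P * ((x *: 'X - 1) * g)).
    by rewrite -!mul_polyC; ring.
  by rewrite -xg exprZn exprS -!mul_polyC polyCM; ring.
by rewrite dvdp_sub ?dvdp_mull.
Qed.

Lemma revprod_coef0 s : (revprod s)`_0 = 1.
Proof.
rewrite -horner_coef0 horner_prod big1// => x _.
by rewrite !hornerE ?mulr0 ?subr0.
Qed.

Lemma size_revprod s : (size (revprod s) <= (size s).+1)%N.
Proof.
elim: s => [|x s IH]; first by rewrite /revprod big_nil size_poly1.
rewrite /revprod big_cons (leq_trans (size_polyMleq _ _))//.
have : (size (1 - x *: 'X : {poly F})%R <= 2)%N.
  rewrite (leq_trans (size_polyD _ _))// geq_max size_poly1 size_polyN/=.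
  by rewrite (leq_trans (size_scale_leq _ _))// size_polyX.
move=> h; rewrite -/(revprod s).
have := leq_add h IH; case: (_ + _)%N => //= m.
Qed.

Lemma dvdXn_coef n (p : {poly F}) k : 'X^n %| p -> (k < n)%N -> p`_k = 0.
Proof. by move=> /dvdpP[q ->] kn; rewrite coefMXn kn. Qed.

(** The difference p of the two products satisfies p' + p S = 0 modulo X^n with p(0) = 0.
    Coefficient k of this relation expresses (k+1) p_(k+1) through lower coefficients, so in
    characteristic 0 all of them vanish up to degree n, which is also the degree bound. *)
Lemma revprod_eq s t : size s = size t ->
  (forall k, (k < size s)%N ->
     \sum_(x <- s) x ^+ k.+1 = \sum_(x <- t) x ^+ k.+1) ->
  revprod s = revprod t.
Proof.
move=> st h; set n := size s in h.
have S : psum_poly s n = psum_poly t n.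
  by apply/polyP => k; rewrite !coef_poly; case: ifP => // /h.
have D : 'X^n %| (revprod s - revprod t)^`() +
    (revprod s - revprod t) * psum_poly s n.
  have := dvdp_sub (revprod_log_deriv s n) (revprod_log_deriv t n).
  rewrite -S => D; rewrite derivB mulrBl.
  by move: D; rewrite opprD addrACA.
apply/eqP; rewrite -subr_eq0; apply/eqP/polyP => k; rewrite coef0.
have [kn|] := leqP k n; last first.
  move=> nk; rewrite nth_default//; apply: (leq_trans _ nk).
  rewrite (leq_trans (size_polyD _ _))// geq_max size_polyN size_revprod.
  by rewrite /n st size_revprod.
set p := revprod s - revprod t in D *.
elim/ltn_ind: k kn => -[_ _|k IH kn].
  by rewrite coefB !revprod_coef0 subrr.
have := dvdXn_coef D kn; rewrite coefD coef_deriv coefM big1.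
  by move/eqP; rewrite addr0 mulrn_eq0/= => /eqP.
move=> i _; rewrite IH ?mul0r //.
exact: leq_trans (leq_ord i) (ltnW kn).
Qed.

Lemma revprod_root s t x : revprod s = revprod t ->
  x != 0 -> x \in s -> x \in t.
Proof.
move=> st x0 xs; have /(congr1 (fun p => p.[x^-1])) := st.
rewrite !horner_prod (big_rem x xs)/= !hornerE divff// subrr mul0r.
move=> /esym/eqP; rewrite prodf_seq_eq0 => /hasP[y yt /=].
rewrite !hornerE subr_eq0 => /eqP xy.
suff -> : x = y by [].
by rewrite -[LHS]mul1r xy mulfVK.
Qed.

Lemma revprod_cancel s t x : revprod s = revprod t -> x \in s -> x \in t ->
  revprod (rem x s) = revprod (rem x t).
Proof.
rewrite /revprod => + xs xt; rewrite (big_rem x xs) (big_rem x xt)/=.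
apply: mulfI; apply/eqP => /(congr1 (fun p : {poly F} => p`_0))/eqP.
by rewrite coefB coefZ coefX coef1 coef0 mulr0 subr0 oner_eq0.
Qed.

(** A common element is removed at each step. A nonzero head of either list lies in the other,
    because its inverse is a root of the product; if both heads are 0, then 0 is common. Equal sizes
    make up for the zeros that [revprod] does not see. *)
Lemma revprod_perm_eq s t : size s = size t -> revprod s = revprod t ->
  perm_eq s t.
Proof.
move: {2}(size s) (erefl (size s)) => n.
elim: n s t => [|n IH] s t ss st stE.
  by move: st; rewrite ss (size0nil ss) => /esym/size0nil ->.
have [x xs xt] : exists2 x, x \in s & x \in t.
  case: s t ss st stE => [|x s] [|y t]// _ _ stE.
  have [x0|x0] := eqVneq x 0; last first.
    by exists x; rewrite ?mem_head// (revprod_root stE)// mem_head.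
  have [y0|y0] := eqVneq y 0.
    by exists 0; rewrite ?x0 ?y0 mem_head.
  by exists y; rewrite ?mem_head// (revprod_root (esym stE))// mem_head.
rewrite (perm_trans (perm_to_rem xs))// perm_sym.
rewrite (perm_trans (perm_to_rem xt))// perm_sym perm_cons.
by apply: IH; rewrite ?size_rem ?ss ?st//; [rewrite -st ss|exact: revprod_cancel].
Qed.

Lemma psum_perm_eq s t : size s = size t ->
  (forall k, (k < size s)%N ->
     \sum_(x <- s) x ^+ k.+1 = \sum_(x <- t) x ^+ k.+1) ->
  perm_eq s t.
Proof. by move=> st h; apply/revprod_perm_eq/revprod_eq. Qed.

End power_sums.

Lemma psum_ffun_perm (F : numFieldType) (I : finType) d (u : I -> F)
    (s t : {ffun 'I_d -> I}) : injective u ->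
  (forall j : 'I_d, \sum_(i < d) u (s i) ^+ j.+1 = \sum_(i < d) u (t i) ^+ j.+1) ->
  exists sg : {perm 'I_d}, t = [ffun i => s (sg i)].
Proof.
move=> ui h.
have /tuple_permP[sg sgE] : perm_eq [tuple u (t i) | i < d] [tuple u (s i) | i < d].
  apply: psum_perm_eq; rewrite !size_tuple// => k kd.
  by rewrite !big_map -!enumT !big_enum; apply/esym/(h (Ordinal kd)).
exists sg; apply/ffunP => i; rewrite ffunE; apply: ui.
move/val_inj: sgE => /(congr1 (fun v => tnth v i)).
by rewrite !tnth_mktuple.
Qed.

(** Only an upper bound: repeated values in s make different permutations yield the same t. *)
Lemma card_ffun_perm (I : finType) d (s : {ffun 'I_d -> I}) :
  (#|[pred t : {ffun 'I_d -> I} |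
      [exists sg : {perm 'I_d}, t == [ffun i => s (sg i)]]]| <= d`!)%N.
Proof.
rewrite -card_Sn.
apply: leq_trans (leq_image_card (fun sg : {perm 'I_d} => [ffun i => s (sg i)]) _).
apply: subset_leq_card; apply/fintype.subsetP => t.
by rewrite inE => /existsP[sg /eqP ->]; exact: fintype.image_f.
Qed.

(** A Schur test: w_s w_t is at most half of w_s^2 + w_t^2, symmetry of E makes the two halves
    equal, and each row of E has at most d! entries. The sum of w_s^2 over all maps s factors as a
    d-th power. *)
Lemma sum_ffun_perm_le (R : realFieldType) (I : finType) d (c : I -> R)
    (E : rel {ffun 'I_d -> I}) :
  symmetric E ->
  (forall s t, E s t -> exists sg : {perm 'I_d}, t = [ffun i => s (sg i)]) ->
  \sum_(s : {ffun 'I_d -> I}) \sum_(t : {ffun 'I_d -> I})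
     (\prod_i c (s i)) * (\prod_i c (t i)) * (E s t)%:R <=
  d`!%:R * (\sum_i c i ^+ 2) ^+ d.
Proof.
move=> Esym hE; pose w (s : {ffun 'I_d -> I}) := \prod_i c (s i).
have H s : \sum_t w s ^+ 2 * (E s t)%:R <= d`!%:R * w s ^+ 2.
  rewrite -mulr_sumr mulrC ler_wpM2r ?sqr_ge0//.
  rewrite -natr_sum ler_nat -big_mkcond sum1_card.
  apply: leq_trans (card_ffun_perm s); apply: subset_leq_card.
  apply/fintype.subsetP => t; rewrite !inE => /hE[sg ->].
  by apply/existsP; exists sg.
have le s t : w s * w t * (E s t)%:R <=
    2^-1 * (w s ^+ 2 * (E s t)%:R) + 2^-1 * (w t ^+ 2 * (E t s)%:R).
  rewrite (Esym t s) !mulrA -mulrDl ler_wpM2r ?ler0n//.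
  by have := sqr_ge0 (w s - w t); lra.
apply: (@le_trans _ _ (\sum_s \sum_t w s ^+ 2 * (E s t)%:R)).
  apply: (@le_trans _ _ (\sum_s \sum_t (2^-1 * (w s ^+ 2 * (E s t)%:R) +
      2^-1 * (w t ^+ 2 * (E t s)%:R)))).
    by apply: ler_sum => s _; apply: ler_sum => t _; exact: le.
  under eq_bigr do rewrite big_split/=.
  rewrite big_split/= [X in _ + X]exchange_big/=.
  set S := leRHS; suff -> : \sum_s \sum_t 2^-1 * (w s ^+ 2 * (E s t)%:R) = 2^-1 * S.
    by lra.
  by rewrite /S mulr_sumr; apply: eq_bigr => s _; rewrite mulr_sumr.
apply: (@le_trans _ _ (\sum_s d`!%:R * w s ^+ 2)).
  by apply: ler_sum => s _; exact: H.
rewrite -mulr_sumr ler_wpM2l ?ler0n// -[X in _ ^+ X]card_ord -prodr_const.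
rewrite bigA_distr_bigA/=.
by apply: ler_sum => s _; rewrite -prodrXl.
Qed.

(** * Orthogonality of the characters on the unit cube *)

Section orthogonality.
Context {R : realType}.

Lemma integrable_cos dd (T : measurableType dd) (P : probability T R) (g : T -> R) :
  measurable_fun setT g -> P.-integrable setT (fun x => (cos (g x))%:E).
Proof.
move=> mg; apply: measurable_bounded_integrable => //.
- by rewrite ltey_eq fin_num_measure.
- exact: measurableT_comp (continuous_measurable_fun (@continuous_cos R)) mg.
- exists 1; split => // M M1 x _ /=.
  by rewrite (le_trans _ (ltW M1))// ler_norml cos_geN1 cos_le1.
Qed.

Lemma sin_int (k : int) (th : R) : sin (2 * pi * k%:~R + th) = sin th.
Proof.
have nat n u : sin (2 * pi * n%:R + u : R) = sin u.
  elim: n u => [|n IH] u; first by rewrite mulr0 add0r.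
  have -> : 2 * pi * n.+1%:R + u = 2 * pi * n%:R + u + pi *+ 2.
    by rewrite -[n.+1%:R]natr1 -mulr_natl; ring.
  by rewrite sinD2pi.
case: k => n; first by rewrite -pmulrn nat.
rewrite NegzE mulrNz mulrN -pmulrn.
by rewrite -[LHS](nat n.+1) addrA subrr add0r.
Qed.

Lemma integral_unit_interval (f : R -> \bar R) :
  (@unit_interval_measure R).-integrable setT f ->
  (\int[@unit_interval_measure R]_t f t =
   \int[lebesgue_measure]_(t in `[0%R, 1%R]) f t)%E.
Proof.
move=> fi.
pose D : set (measurableTypeR R) := [set` `[0%R, 1%R]].
rewrite (@negligible_integral _ _ _ _ setT (~` D))//.
- rewrite setTD setCK; apply: eq_measure_integral => A mA A01.
  transitivity (lebesgue_measure (A `&` D)); first by [].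
  by rewrite setIidl.
- by apply: measurableC; exact: measurable_itv.
- transitivity (lebesgue_measure (~` D `&` D)); first by [].
  by rewrite setICl measure0.
Qed.

Lemma integral_cos_unit (k : int) (th : R) :
  (\int[@unit_interval_measure R]_t (cos (2 * pi * (k%:~R * t) + th))%:E
    = ((k == 0)%:R * cos th)%:E)%E.
Proof.
rewrite integral_unit_interval; last first.
  apply: integrable_cos; apply: measurable_funD => //.
  by apply: measurable_funM => //; exact: measurable_funM.
have [->|k0] := eqVneq k 0.
  under eq_integral do rewrite mul0r mulr0 add0r.
  by rewrite integral_cst//= lebesgue_measure_itv/= lte01 oppr0 adde0 mule1 mul1r.
pose c : R := 2 * pi * k%:~R.
have c0 : c != 0.
  by rewrite /c !mulf_eq0 intr_eq0 !negb_or k0 pnatr_eq0 (gt_eqF (pi_gt0 R)).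
pose G (t : R) : R := c^-1 * sin (c * t + th).
have dG (t : R) : is_derive t (1 : R) G (cos (c * t + th)).
  rewrite /G; apply: is_derive_eq.
  by rewrite addr0 /GRing.scale/= mulr1 mulrCA mulVf// mulr1.
rewrite (_ : (fun t => _) = (fun t : R => (cos (c * t + th))%:E)); last first.
  by apply/funext => t; rewrite /c mulrA.
have cG : continuous G.
  by move=> t; apply: differentiable_continuous; apply/derivable1_diffP; case: (dG t).
have cc : continuous (fun t : R => cos (c * t + th)).
  move=> t; apply: (@continuous_comp _ _ _ (fun t : R => c * t + th) cos).
    by apply: cvgD; [apply: cvgM => //; exact: cvg_cst|exact: cvg_cst].
  exact: continuous_cos.
rewrite (@continuous_FTC2 _ _ G)//.
- rewrite -EFinB mul0r /G mulr0 add0r mulr1 sin_int subrr//.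
- exact: continuous_subspaceT.
- split.
  + by move=> t _; case: (dG t).
  + exact: cvg_at_right_filter (cG 0).
  + exact: cvg_at_left_filter (cG 1).
- by move=> t _; rewrite derive1E; case: (dG t).
Qed.

Lemma measurable_phase d (w : 'I_d -> R) :
  measurable_fun setT
    (fun x : d.-tuple (measurableTypeR R) => \sum_j w j * tnth x j).
Proof.
apply: measurable_sum => j; apply: measurable_funM => //.
exact: measurable_tnth.
Qed.

(* The phase th is what lets the induction on d go through without splitting
   cos (u + v) into products. *)
Lemma integral_cos_cube d (w : 'I_d -> int) (th : R) :
  (\int[unit_cube_measure d]_x
     (cos (2 * pi * (\sum_j (w j)%:~R * tnth x j) + th))%:E
    = ([forall j, w j == 0]%:R * cos th)%:E)%E.
Proof.
elim: d w th => [|d IH] w th.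
  rewrite integral_dirac//=; last first.
    apply/measurable_EFinP.
    apply: measurableT_comp (continuous_measurable_fun (@continuous_cos R)) _.
    apply: measurable_funD => //; apply: measurable_funM => //.
    exact: measurable_phase.
  rewrite diracT mul1e big_ord0 mulr0 add0r.
  by rewrite (_ : [forall j, _]) ?mul1r//; apply/forallP => -[].
rewrite [unit_cube_measure _]/=.
have mf : measurable_fun setT (fun x : d.+1.-tuple (measurableTypeR R) =>
   2 * pi * (\sum_j (w j)%:~R * tnth x j) + th).
  apply: measurable_funD => //; apply: measurable_funM => //.
  exact: measurable_phase.
pose f (z : measurableTypeR R * d.-tuple (measurableTypeR R)) : \bar R :=
  (cos (2 * pi * (\sum_j (w j)%:~R * tnth (tuple_cons z) j) + th))%:E.
transitivity (\int[(@unit_interval_measure R \x unit_cube_measure d)]_z f z)%E.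
  rewrite integral_distribution//.
- apply/measurable_EFinP.
  exact: measurableT_comp (continuous_measurable_fun (@continuous_cos R)) mf.
- apply: integrable_cos; apply: (measurableT_comp mf).
  exact: measurable_tuple_cons.
rewrite -(@integral12_prod_meas1 _ _ _ _ _ unit_interval_measure
  (unit_cube_measure d) f); last first.
  apply: integrable_cos; apply: (measurableT_comp mf).
  exact: measurable_tuple_cons.
transitivity (\int[@unit_interval_measure R]_t
  ([forall j, w (lift ord0 j) == 0]%:R%:E *
   (cos (2 * pi * ((w ord0)%:~R * t) + th))%:E))%E.
  apply: eq_integral => t _; rewrite -EFinM -IH.
  apply: eq_integral => x _; rewrite /f/=; congr (cos _)%:E.
  rewrite big_ord_recl/= mulrDr addrAC addrC addrA.
  rewrite -addrA; congr (_ + (_ + _)).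
    by congr (_ * _); apply: eq_bigr => j _; rewrite !(tnth_nth 0).
rewrite integralZl//; last first.
  apply: integrable_cos; apply: measurable_funD => //.
  by apply: measurable_funM => //; exact: measurable_funM.
rewrite integral_cos_unit -EFinM mulrA.
congr (_ * _)%:E; rewrite -natrM mulnb; congr (nat_of_bool _)%:R.
apply/andP/forallP => [[/forallP w1 w0] j|w0].
  by case: (unliftP ord0 j) => [i|] ->.
by split=> //; apply/forallP.
Qed.

(** The frequencies [w i] may repeat, hence the double sum instead of a diagonal one: repetition is
    exactly what occurs when a d-th power is expanded over tuples. *)
Lemma integral_normc2_cube d (I : finType) (c : I -> R) (w : I -> 'I_d -> int) :
  (\int[unit_cube_measure d]_x
     ((normc (\sum_i (c i)%:C%C *
        e (\sum_j (w i j)%:~R * tnth x j))) ^+ 2)%:E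
   = (\sum_i \sum_k c i * c k * [forall j, w i j == w k j]%:R)%:E)%E.
Proof.
pose ph i (x : d.-tuple (measurableTypeR R)) : R := \sum_j (w i j)%:~R * tnth x j.
(* The trailing + 0 gives the cosine the shape required by [integral_cos_cube], with phase 0. *)
have E x : (normc (\sum_i (c i)%:C%C * e (ph i x))) ^+ 2
   = \sum_i \sum_k c i * c k * cos (2 * pi * (\sum_j (w i j - w k j)%:~R * tnth x j) + 0).
  have -> : \sum_i (c i)%:C%C * e (ph i x) =
    ((\sum_i c i * cos (2 * pi * ph i x)) +i* (\sum_i c i * sin (2 * pi * ph i x)))%C.
    elim/big_rec3: _ => // i y1 y2 y3 _ ->; rewrite /e; by simpc.
  rewrite /normc sqr_sqrtr ?addr_ge0 ?sqr_ge0//.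
  rewrite !expr2 !mulr_suml -big_split/=; apply: eq_bigr => i _.
  rewrite [X in X + _]mulr_sumr [X in _ + X]mulr_sumr -big_split/=; apply: eq_bigr => k _.
  have -> : 2 * pi * (\sum_j (w i j - w k j)%:~R * tnth x j) + 0 =
     2 * pi * ph i x - 2 * pi * ph k x.
    rewrite addr0 -mulrBr -sumrB; congr (_ * _); apply: eq_bigr => j _.
    by rewrite intrB mulrBl.
  by rewrite cosB; ring.
have iC i k : (unit_cube_measure d).-integrable setT (fun x =>
    ((c i * c k)%:E * (cos (2 * pi *
       (\sum_j (w i j - w k j)%:~R * tnth x j) + 0))%:E)%E).
  apply: integrableZl => //; apply: integrable_cos.
  by apply: measurable_funD => //; apply: measurable_funM => //; exact: measurable_phase.
transitivity (\int[unit_cube_measure d]_x (\sum_i \sum_k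
    ((c i * c k)%:E * (cos (2 * pi *
       (\sum_j (w i j - w k j)%:~R * tnth x j) + 0))%:E)))%E.
  apply: eq_integral => x _; rewrite E -sumEFin; apply: eq_bigr => i _.
  by rewrite -sumEFin; apply: eq_bigr => k _; rewrite -EFinM.
rewrite integral_sum//; last by move=> i; exact: integrable_sum.
rewrite -sumEFin; apply: eq_bigr => i _.
rewrite integral_sum// -sumEFin; apply: eq_bigr => k _.
rewrite integralZl//; last first.
  apply: integrable_cos.
  by apply: measurable_funD => //; apply: measurable_funM => //; exact: measurable_phase.
rewrite integral_cos_cube cos0 mulr1 -EFinM.
by congr (_ * _%:R)%:E; congr nat_of_bool; apply: eq_forallb => j; rewrite subr_eq0.
Qed.

End orthogonality.

(** * Norms of the partial sums *)

Section partial_sums.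
Context {R : realType}.
Implicit Types (a : int -> R) (d N M : nat).

Definition energy a N : R := \sum_(0 <= k < N.*2.+1) a (k%:Z - N%:Z) ^+ 2.

(** The shift n = k - N depends on N, so a shorter symmetric sum is not a prefix of a longer one;
    padding with zeros at both ends aligns them. *)
Lemma sum_centered_widen (V : nmodType) (h : int -> V) M N : (M <= N)%N ->
  (forall n : int, (M < `|n|)%N -> h n = 0) ->
  \sum_(0 <= k < N.*2.+1) h (k%:Z - N%:Z) =
  \sum_(0 <= k < M.*2.+1) h (k%:Z - M%:Z).
Proof.
move=> + h0; elim: N => [|N IH]; first by rewrite leqn0 => /eqP ->.
rewrite leq_eqVlt ltnS => /predU1P[->//|MN].
rewrite doubleS big_nat_recl// big_nat_recr//= -IH//.
rewrite !h0 ?add0r ?addr0.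
- by apply: eq_big_nat => k _; congr h; rewrite -addn1 -[N.+1]addn1 !PoszD; ring.
- by lia.
- by lia.
Qed.

Lemma energy_widen a M N : (M <= N)%N ->
  energy a M = energy (fun n => if (`|n| <= M)%N then a n else 0) N.
Proof.
move=> MN; rewrite /energy (@sum_centered_widen _
  (fun n => (if (`|n| <= M)%N then a n else 0) ^+ 2) M N)//.
  by apply: eq_big_nat => k; rewrite ltnS => /= kM; rewrite ifT//; lia.
by move=> n Mn; rewrite leqNgt Mn /= expr0n.
Qed.

(** With increments written as energies of cut-off coefficients, comparing increments of a and A
    reduces to [energy_le]. *)
Lemma energyB a M N : (M <= N)%N ->
  energy a N - energy a M = energy (fun n => if (`|n| <= M)%N then 0 else a n) N.
Proof.
move=> MN; rewrite (energy_widen a MN) /energy -sumrB; apply: eq_bigr => k _.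
by case: ifP; rewrite expr0n/= ?subrr ?subr0.
Qed.

Lemma energy_ge0 a N : 0 <= energy a N.
Proof. by apply: sumr_ge0 => k _; exact: sqr_ge0. Qed.

Lemma le_energy a M N : (M <= N)%N -> energy a M <= energy a N.
Proof. by move=> MN; rewrite -subr_ge0 energyB// energy_ge0. Qed.

Lemma energy_le a (A : int -> R) N : (forall n, `|a n| <= A n) ->
  energy a N <= energy A N.
Proof.
move=> aA; apply: ler_sum => k _; rewrite -real_normK ?num_real//.
by rewrite ler_sqr ?nnegrE// (le_trans _ (aA _)).
Qed.

Lemma energyB_le a (A : int -> R) M N : (M <= N)%N -> (forall n, `|a n| <= A n) ->
  energy a N - energy a M <= energy A N - energy A M.
Proof.
move=> MN aA; rewrite !energyB//; apply: energy_le => n.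
by case: ifP; rewrite ?normr0.
Qed.

Lemma expsum_partialE d a N (x : d.-tuple (measurableTypeR R)) :
  expsum_partial a N x = \sum_(k < N.*2.+1) (a (k%:Z - N%:Z))%:C%C *
    e (\sum_(j < d) ((k%:Z - N%:Z) ^+ j.+1)%:~R * tnth x j).
Proof.
rewrite /expsum_partial big_mkord; apply: eq_bigr => k _; congr (_ * e _).
by apply: eq_bigr => j _; rewrite tnth_mktuple rmorphXn.
Qed.

Lemma expsum_partialB d a M N (x : d.-tuple (measurableTypeR R)) : (M <= N)%N ->
  expsum_partial a N x - expsum_partial a M x =
  expsum_partial (fun n => if (`|n| <= M)%N then 0 else a n) N x.
Proof.
move=> MN; pose t n : R[i] := e (dotprod (moment_curve d (n%:~R : R)) x).
pose h n := (if (`|n| <= M)%N then a n else 0)%:C%C * t n.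
have -> : expsum_partial a M x = \sum_(0 <= k < M.*2.+1) h (k%:Z - M%:Z).
  by apply: eq_big_nat => k; rewrite ltnS => /= kM; rewrite /h ifT//; lia.
rewrite -(@sum_centered_widen _ h M N)// => [|n Mn]; last by rewrite /h leqNgt Mn mul0r.
rewrite /expsum_partial -sumrB; apply: eq_bigr => k _.
by rewrite /h /t; case: ifP; rewrite ?mul0r ?subr0// subrr.
Qed.

Lemma eD (u v : R) : e (u + v) = e u * e v.
Proof. by rewrite /e mulrDr cosD sinD; simpc; rewrite [X in (_ +i* X)%C]addrC. Qed.

Lemma e_sum (I : finType) (u : I -> R) : e (\sum_i u i) = \prod_i e (u i).
Proof.
elim/big_rec2: _ => [|i y1 y2 _ <-]; last by rewrite eD.
by rewrite /e mulr0 cos0 sin0.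
Qed.

(** The first coordinate of the frequency is n itself, so for positive d distinct indices have
    distinct frequencies and only the diagonal survives. *)
Lemma integral_normc2_expsum d a N : (0 < d)%N ->
  (\int[unit_cube_measure d]_x (normc (expsum_partial a N x) ^+ 2)%:E
   = (energy a N)%:E)%E.
Proof.
move=> d0; under eq_integral do rewrite expsum_partialE.
rewrite integral_normc2_cube /energy big_mkord; congr EFin.
apply: eq_bigr => i _; rewrite (bigD1 i)//= big1 => [|k /eqP ki].
  by rewrite (_ : [forall j, _]) ?mulr1 ?addr0 ?expr2//; apply/forallP => j.
rewrite (_ : [forall j, _] = false) ?mulr0//; apply/negP => /forallP/(_ (Ordinal d0)).
by rewrite /= !expr1 => /eqP/addIr; case => /val_inj/esym.
Qed.

Lemma integral_normc2d_expsum d a N :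
  (\int[unit_cube_measure d]_x (normc (expsum_partial a N x) ^+ (2 * d))%:E
   <= (d`!%:R * energy a N ^+ d)%:E)%E.
Proof.
pose fr (k : 'I_N.*2.+1) : int := k%:Z - N%:Z.
have fr_inj : injective (fun k => (fr k)%:~R : R).
  by move=> i k /= /intr_inj /addIr; case => /val_inj.
have E x : normc (expsum_partial a N x) ^+ (2 * d) =
  normc (\sum_(s : {ffun 'I_d -> 'I_N.*2.+1}) (\prod_i a (fr (s i)))%:C%C *
    e (\sum_(j < d) (\sum_i fr (s i) ^+ j.+1)%:~R * tnth x j)) ^+ 2.
  have nX (z : R[i]) n : normc (z ^+ n) = normc z ^+ n.
    elim: n => [|n IH]; first by rewrite !expr0 ComplexField.Normc.normc1.
    by rewrite !exprS ComplexField.Normc.normcM IH.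
  rewrite mulnC exprM -nX; congr (normc _ ^+ _).
  rewrite expsum_partialE -[X in _ ^+ X](card_ord d) -prodr_const.
  rewrite bigA_distr_bigA/=; apply: eq_bigr => s _.
  rewrite big_split/= rmorph_prod; congr (_ * _).
  rewrite -e_sum exchange_big/=; congr e; apply: eq_bigr => j _.
  by rewrite -mulr_suml rmorph_sum.
under eq_integral do rewrite E.
rewrite integral_normc2_cube lee_fin /energy big_mkord.
pose P (s t : {ffun 'I_d -> 'I_N.*2.+1}) :=
  [forall j : 'I_d, (\sum_i fr (s i) ^+ j.+1) == (\sum_i fr (t i) ^+ j.+1)].
apply: (@sum_ffun_perm_le _ _ _ (fun k => a (fr k)) P) => [s t|s t].
  by apply: eq_forallb => j; rewrite eq_sym.
move=> /forallP st; apply: (psum_ffun_perm fr_inj) => j.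
have /eqP/(congr1 (fun z : int => z%:~R : R)) := st j.
rewrite !rmorph_sum/=; under eq_bigr do rewrite rmorphXn/=.
by move=> ->; apply: eq_bigr => i _; rewrite rmorphXn.
Qed.

Lemma measurable_normc dd (T : measurableType dd) (F : T -> R[i]) :
  measurable_fun setT (fun x => complex.Re (F x)) ->
  measurable_fun setT (fun x => complex.Im (F x)) ->
  measurable_fun setT (fun x => normc (F x)).
Proof.
move=> mr mi.
rewrite (_ : (fun x => _) = (fun x =>
  Num.sqrt (complex.Re (F x) ^+ 2 + complex.Im (F x) ^+ 2))); last first.
  by apply/funext => x; rewrite /normc; case: (F x).
apply: (measurableT_comp (continuous_measurable_fun (@sqrt_continuous R))).
by apply: measurable_funD; apply: measurable_funX.
Qed.

Lemma expsum_partial_Re d a N x : complex.Re (expsum_partial (d:=d) a N x) =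
  \sum_(0 <= k < N.*2.+1) a (k%:Z - N%:Z) *
    cos (2 * pi * (dotprod (moment_curve d (k%:Z - N%:Z)%:~R) x)).
Proof.
rewrite raddf_sum; apply: eq_bigr => k _; rewrite /e; simpc => /=.
by rewrite ?mul0r ?subr0.
Qed.

Lemma expsum_partial_Im d a N x : complex.Im (expsum_partial (d:=d) a N x) =
  \sum_(0 <= k < N.*2.+1) a (k%:Z - N%:Z) *
    sin (2 * pi * (dotprod (moment_curve d (k%:Z - N%:Z)%:~R) x)).
Proof.
rewrite raddf_sum; apply: eq_bigr => k _; rewrite /e; simpc => /=.
by rewrite ?mul0r ?subr0.
Qed.

Lemma measurable_expsum_partial_Re d a N : measurable_fun setT
  (fun x : d.-tuple (measurableTypeR R) => complex.Re (expsum_partial a N x)).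
Proof.
under eq_fun do rewrite expsum_partial_Re.
apply: measurable_sum => k; apply: measurable_funM => //.
apply: measurableT_comp (continuous_measurable_fun (@continuous_cos R)) _.
by apply: measurable_funM => //; exact: measurable_phase.
Qed.

Lemma measurable_expsum_partial_Im d a N : measurable_fun setT
  (fun x : d.-tuple (measurableTypeR R) => complex.Im (expsum_partial a N x)).
Proof.
under eq_fun do rewrite expsum_partial_Im.
apply: measurable_sum => k; apply: measurable_funM => //.
apply: measurableT_comp (continuous_measurable_fun (@continuous_sin R)) _.
by apply: measurable_funM => //; exact: measurable_phase.
Qed.

End partial_sums.

(** * Almost everywhere limits *)

Section general_measure.
Context {R : realType} dd (T : measurableType dd) (P : probability T R).

(** The bounds add up to at most 1, so the sum of the series is integrable and therefore finite
    almost everywhere. *)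
Lemma ae_cvg_series (u : nat -> T -> R) :
  (forall k, measurable_fun setT (u k)) -> (forall k x, 0 <= u k x) ->
  (forall k, (\int[P]_x (u k x)%:E <= (1 / (2 ^ k.+1)%:R)%:E)%E) ->
  {ae P, forall x, cvgn (series (u ^~ x))}.
Proof.
move=> mu u0 ub.
have mE k : measurable_fun setT (fun x => (u k x)%:E) by exact/measurable_EFinP.
have mS : measurable_fun setT (fun x => \sum_(k <oo) (u k x)%:E)%E.
  by apply: ge0_emeasurable_sum => // k x _ _; rewrite lee_fin.
have I1 : P.-integrable setT (fun x => \sum_(k <oo) (u k x)%:E)%E.
  apply/integrableP; split => //.
  under eq_integral => x _.
    rewrite gee0_abs; last by apply: nneseries_ge0 => k _ _; rewrite lee_fin.
    over.
  rewrite integral_nneseries//; last by move=> k x _; rewrite lee_fin.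
  apply: (@le_lt_trans _ _ 1%:E); last by rewrite ltry.
  apply: le_trans (epsilon_trick0 xpredT ler01).
  apply: lee_nneseries => // k _ _; apply: integral_ge0 => x _.
  by rewrite lee_fin.
have := integrable_ae measurableT I1; apply: filterS => x /(_ I) fS.
apply: nondecreasing_is_cvgn.
  by apply: nondecreasing_series => k _ _.
exists (fine (\sum_(k <oo) (u k x)%:E)) => _ [n _ <-].
rewrite -lee_fin fineK// /series/= -sumEFin.
by apply: nneseries_lim_ge => k _ _; rewrite lee_fin.
Qed.

Lemma fatou_ae (g : nat -> T -> R) (h : T -> R) (C : \bar R) :
  (forall k, measurable_fun setT (g k)) -> measurable_fun setT h ->
  (forall k x, 0 <= g k x) -> (forall x, 0 <= h x) ->
  (forall k, (\int[P]_x (g k x)%:E <= C)%E) ->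
  {ae P, forall x, g ^~ x @ \oo --> h x} ->
  (\int[P]_x (h x)%:E <= C)%E.
Proof.
move=> mg mh g0 h0 gC gh.
have mE k : measurable_fun setT (fun x => (g k x)%:E) by exact/measurable_EFinP.
have mhE : measurable_fun setT (fun x => (h x)%:E) by exact/measurable_EFinP.
have mL : measurable_fun setT (fun x => limn_einf (fun k => (g k x)%:E)).
  apply: measurableT_comp => //; apply: measurable_fun_limn_esup => k.
  exact: measurableT_comp.
have -> : (\int[P]_x (h x)%:E = \int[P]_x limn_einf (fun k => (g k x)%:E))%E.
  apply: ge0_ae_eq_integral => //.
  - by move=> x _; rewrite lee_fin.
  - move=> x _; rewrite limn_einf_lim; apply: lime_ge; first exact: is_cvg_einfs.
    apply: nearW => n; apply: le_ereal_inf_tmp => _ [m _ <-].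
    by rewrite lee_fin.
  - apply: filterS gh => x gh _.
    have gE : (fun k => (g k x)%:E) @ \oo --> (h x)%:E.
      by apply: cvg_EFin => //; exact: nearW.
    by have [-> _] := cvg_limn_einf_sup gE.
apply: (le_trans (fatou P measurableT mE _)) => [k x _|]; first by rewrite lee_fin.
rewrite limn_einf_lim; apply: lime_le; first exact: is_cvg_einfs.
apply: nearW => n; apply: le_trans (gC n).
by apply: ereal_inf_lbound; exists n => //=.
Qed.


Definition cmeasurable (F : T -> R[i]) :=
  measurable_fun setT (fun x => complex.Re (F x)) /\
  measurable_fun setT (fun x => complex.Im (F x)).

Lemma cmeasurableB (F G : T -> R[i]) : cmeasurable F -> cmeasurable G ->
  cmeasurable (fun x => F x - G x).
Proof.
move=> [Fr Fi] [Gr Gi]; split.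
- under eq_fun do rewrite raddfB/=; exact: measurable_funB.
- under eq_fun do rewrite raddfB/=; exact: measurable_funB.
Qed.

Lemma measurable_normcX (F : T -> R[i]) m : cmeasurable F ->
  measurable_fun setT (fun x => normc (F x) ^+ m).
Proof. by move=> [Fr Fi]; apply/measurable_funX/measurable_normc. Qed.

Lemma measurable_normcXE (F : T -> R[i]) m : cmeasurable F ->
  measurable_fun setT (fun x => (normc (F x) ^+ m)%:E).
Proof. by move=> mF; apply/measurable_EFinP/measurable_normcX. Qed.

Lemma normc_ge0 (z : R[i]) : 0 <= normc z.
Proof. by case: z => a b; rewrite /normc sqrtr_ge0. Qed.

Lemma ler_dist_normc (z w : R[i]) : `|normc z - normc w| <= normc (z - w).
Proof.
rewrite ler_norml; apply/andP; split.
  have := le_normcD (w - z) z; rewrite subrK -[w - z]opprB normcN; lra.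
by have := le_normcD (z - w) w; rewrite subrK; lra.
Qed.

(** Indices [K k] are chosen with squared L^2 distance to F at most 2^-(k+1). The series of squared
    pointwise distances then converges almost everywhere, so its terms tend to 0 there. *)
Lemma fatou_L2 (f : nat -> T -> R[i]) (F : T -> R[i]) (m : nat) (C : \bar R) :
  cmeasurable F -> (forall k, cmeasurable (f k)) ->
  (forall eps, 0 < eps -> exists N, forall k, (N <= k)%N ->
     (\int[P]_x (normc (F x - f k x) ^+ 2)%:E <= eps%:E)%E) ->
  (forall k, (\int[P]_x (normc (f k x) ^+ m)%:E <= C)%E) ->
  (\int[P]_x (normc (F x) ^+ m)%:E <= C)%E.
Proof.
move=> mF mf cv fC.
have /choice[K HK] (k : nat) : exists N, (\int[P]_x (normc (F x - f N x) ^+ 2)%:E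
    <= (1 / (2 ^ k.+1)%:R)%:E)%E.
  have [|N HN] := cv (1 / (2 ^ k.+1)%:R); last by exists N; exact: HN.
  by rewrite divr_gt0// ltr0n expn_gt0.
apply: (@fatou_ae (fun k x => normc (f (K k) x) ^+ m)) => //.
- by move=> k; exact: measurable_normcX.
- exact: measurable_normcX.
- by move=> k x; rewrite exprn_ge0// normc_ge0.
- by move=> x; rewrite exprn_ge0// normc_ge0.
have := @ae_cvg_series (fun k x => normc (F x - f (K k) x) ^+ 2).
move=> /(_ (fun k => measurable_normcX 2 (cmeasurableB mF (mf (K k))))).
move=> /(_ (fun k x => sqr_ge0 _)) /(_ HK).
apply: filterS => x /cvg_series_cvg_0 c0.
have c1 : (fun k => normc (F x - f (K k) x)) @ \oo --> (0 : R).
  rewrite -(sqrtr0 R).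
  under eq_fun do rewrite -[normc _]ger0_norm ?normc_ge0// -sqrtr_sqr.
  by apply: continuous_cvg => //; exact: sqrt_continuous.
have c2 : (fun k => normc (f (K k) x)) @ \oo --> normc (F x).
  apply/cvgrPdist_le => eps e0.
  move/cvgrPdist_le : c1 => /(_ _ e0); apply: filterS => k.
  rewrite sub0r normrN (ger0_norm (normc_ge0 _)).
  exact/le_trans/ler_dist_normc.
exact: (continuous_cvg _ (@exprn_continuous _ m _) c2).
Qed.

End general_measure.

(** * Sums of infinite series in L^2 *)

Section ereal_lemmas.
Context {R : realType}.

Lemma cvge0P (Z : nat -> \bar R) : (forall k, 0 <= Z k)%E ->
  (Z @ \oo --> 0%E) <->
  (forall eps : R, 0 < eps -> exists N, forall k, (N <= k)%N -> (Z k <= eps%:E)%E).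
Proof.
move=> Z0; split=> [Zc eps e0|H].
  have : nbhs (0%E : \bar R) [set y | (y < eps%:E)%E].
    by apply: open_nbhs_nbhs; split; [exact: open_ereal_lt_ereal|rewrite /= lte_fin].
  by move/Zc => [N _ HN]; exists N => k Nk; apply/ltW/HN.
apply/fine_cvgP; split.
  (* Early terms may be infinite; the threshold for eps = 1 makes the tail finite. *)
  have [N HN] := H _ ltr01; exists N => // k /= Nk.
  by rewrite ge0_fin_numE// (le_lt_trans (HN _ Nk))// ltry.
apply/cvgrPdist_le => eps e0; have [N HN] := H _ e0; exists N => // k /= Nk.
rewrite sub0r normrN ger0_norm ?fine_ge0//.
have Zf : Z k \is a fin_num by rewrite ge0_fin_numE// (le_lt_trans (HN _ Nk))// ltry.
by rewrite -lee_fin fineK// HN.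
Qed.

Lemma le_poweR_iff (x y : \bar R) (r : R) : 0 < r -> (0 <= x)%E -> (0 <= y)%E ->
  (x `^ r <= y `^ r)%E = (x <= y)%E.
Proof.
have mono (u v : \bar R) (t : R) : 0 <= t -> (0 <= u)%E -> (0 <= v)%E ->
    (u <= v)%E -> (u `^ t <= v `^ t)%E.
  by move=> t0 u0 v0; apply: gt0_ler_poweR; rewrite ?in_itv/= ?u0 ?v0 ?leey.
move=> r0 x0 y0; apply/idP/idP => [xy|]; last exact/mono/y0/x0/ltW.
have cancel (u : \bar R) : (0 <= u)%E -> ((u `^ r) `^ r^-1)%E = u.
  by move=> u0; rewrite -poweRrM mulfV ?gt_eqF// poweRe1.
rewrite -(cancel x)// -(cancel y)// mono ?poweR_ge0//.
by rewrite invr_ge0 ltW.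
Qed.

(** Trades norms for integrals: the L^2 convergence in [is_expsum] becomes a bound on integrals of
    squares. *)
Lemma cvge0_poweR (Y : nat -> \bar R) (r : R) : 0 < r -> (forall k, 0 <= Y k)%E ->
  ((fun k => Y k `^ r)%E @ \oo --> 0%E) <->
  (forall eps : R, 0 < eps -> exists N, forall k, (N <= k)%N -> (Y k <= eps%:E)%E).
Proof.
move=> r0 Y0; rewrite cvge0P; last by move=> k; exact: poweR_ge0.
split=> H eps e0.
  have [|N HN] := H (eps `^ r); first exact: powR_gt0.
  exists N => k Nk; have e0' : (0 <= eps%:E)%E by rewrite lee_fin ltW.
  by rewrite -(le_poweR_iff r0 (Y0 k) e0') poweR_EFin; exact: HN.
have [|N HN] := H (eps `^ r^-1); first exact: powR_gt0.
exists N => k Nk; have := HN k Nk.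
have p0 : (0 <= (eps `^ r^-1)%:E)%E by rewrite lee_fin powR_ge0.
rewrite -(le_poweR_iff r0 (Y0 k) p0) poweR_EFin -powRrM mulVf ?gt_eqF//.
by rewrite (powRr1 (ltW e0)).
Qed.

End ereal_lemmas.

(** * Lebesgue norms on a probability space *)

Section lnorm.
Context {R : realType}.

Lemma Lnorm_ge0_natE dd (T : measurableType dd) (P : probability T R) m (g : T -> R) :
  (forall x, 0 <= g x) ->
  (Lnorm P m%:R%:E (fun x => (g x)%:E) = (\int[P]_x (g x ^+ m)%:E) `^ (m%:R)^-1)%E.
Proof.
move=> g0; rewrite unlock; congr (_ `^ _)%E; apply: eq_integral => x _.
by rewrite abse_EFin poweR_EFin ger0_norm// powR_mulrn.
Qed.

(** Hölder for |g|^p against the constant 1, with exponent q/p; total mass 1 makes the second factor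
    1. The case p = q is split off because the conjugate exponent would be infinite. *)
Lemma le_Lnorm dd (T : measurableType dd) (P : probability T R) (g : T -> R) (p q : R) :
  measurable_fun setT g -> 0 < p -> p <= q ->
  (Lnorm P p%:E (fun x => (g x)%:E) <= Lnorm P q%:E (fun x => (g x)%:E))%E.
Proof.
move=> mg p0; rewrite le_eqVlt => /predU1P[->//|pq].
have q0 : 0 < q := lt_trans p0 pq.
pose r := q / p; pose r' := (1 - r^-1)^-1.
have mgp : measurable_fun setT (fun x => `|g x| `^ p).
  by apply: (measurableT_comp (measurable_powR p)); exact: measurableT_comp.
have r0 : 0 < r by rewrite divr_gt0.
have r'0 : 0 < r'.
  by rewrite invr_gt0 subr_gt0 invf_lt1// ltr_pdivlMr// mul1r.
have := @hoelder _ _ _ P (fun x => `|g x| `^ p) (cst 1) r r' mgp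
  (measurable_cst _) r0 r'0.
rewrite /r' invrK subrKC => /(_ erefl).
rewrite -[(1 - r^-1)^-1]/r'.
rewrite (_ : Lnorm P r'%:E _ = 1%E) ?mule1; last first.
  rewrite Lnorm_cst1; transitivity (1 `^ r'^-1 : \bar R)%E; last exact: poweR1r.
  by congr (_ `^ _)%E; exact: probability_setT.
rewrite Lnorm1 => H.
pose I (t : R) := (\int[P]_x (`|g x| `^ t)%:E)%E.
have I0 t : (0 <= I t)%E by apply: integral_ge0 => x _; rewrite lee_fin powR_ge0.
have E t : Lnorm P t%:E (fun x => (g x)%:E) = (I t `^ t^-1)%E.
  by rewrite unlock; congr (_ `^ _)%E; apply: eq_integral => x _; rewrite poweR_EFin.
have {H} : (I p <= I q `^ r^-1)%E.
  have -> : I p = (\int[P]_x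
      `|(EFin \o ((fun x => `|g x| `^ p) \* cst 1)%R) x|)%E.
    apply: eq_integral => x _.
    by rewrite /= mulr1 (ger0_norm (powR_ge0 _ _)).
  apply: (le_trans H); rewrite unlock le_eqVlt; apply/orP; left; apply/eqP.
  congr (_ `^ _)%E; apply: eq_integral => x _.
  rewrite poweR_EFin ger0_norm ?powR_ge0// -powRrM /r mulrC divfK//.
  by rewrite gt_eqF.
have pi0 : 0 < p^-1 by rewrite invr_gt0.
rewrite -(le_poweR_iff pi0 (I0 p) (poweR_ge0 _ _)) -poweRrM !E.
by rewrite /r invf_div mulrAC divff ?mul1r// gt_eqF.
Qed.

End lnorm.

(** * Bessel's inequality and existence of L^2 sums *)

Section main.
Context {R : realType}.
Implicit Types (a : int -> R) (d : nat).

Lemma cmeasurable_expsum_partial d a N :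
  cmeasurable (fun x : d.-tuple (measurableTypeR R) => expsum_partial a N x).
Proof.
by split; [exact: measurable_expsum_partial_Re|exact: measurable_expsum_partial_Im].
Qed.

Lemma is_expsumP d a (F : d.-tuple (measurableTypeR R) -> R[i]) :
  is_expsum a F <-> cmeasurable F /\
  (forall eps : R, 0 < eps -> exists N, forall k, (N <= k)%N ->
   (\int[unit_cube_measure d]_x (normc (F x - expsum_partial a k x) ^+ 2)%:E
     <= eps%:E)%E).
Proof.
have E : (fun N => Lnorm_cube 2 (fun x => F x - expsum_partial a N x)) =
  (fun N => (\int[unit_cube_measure d]_x (normc (F x - expsum_partial a N x) ^+ 2)%:E)
    `^ 2^-1)%E.
  apply/funext => N; rewrite /Lnorm_cube Lnorm_ge0_natE// => x.
  exact: normc_ge0.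
have Y0 N : (0 <= \int[unit_cube_measure d]_x
    (normc (F x - expsum_partial a N x) ^+ 2)%:E)%E.
  by apply: integral_ge0 => x _; rewrite lee_fin sqr_ge0.
have C := cvge0_poweR (r := 2^-1) _ Y0.
rewrite /is_expsum E; split=> [[Fr Fi /C H]|[[Fr Fi] H]].
  by split => //; apply: H; rewrite invr_gt0.
by split => //; apply/C.
Qed.

(** A weighted triangle inequality. With eta free, it replaces Minkowski's inequality for integrals
    of squares: the error is made small first, then eta. *)
Lemma normc_sq_split (z w : R[i]) (eta : R) : 0 < eta ->
  normc z ^+ 2 <= (1 + eta) * normc w ^+ 2 + (1 + eta^-1) * normc (w - z) ^+ 2.
Proof.
move=> e0; have h : normc z <= normc w + normc (w - z).
  have := ler_dist_normc z w; rewrite -(normcN (z - w)) opprB ler_norml.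
  by move=> /andP[]; lra.
have := normc_ge0 z; have := normc_ge0 w; have := normc_ge0 (w - z).
set u := normc (w - z) in h *; set v := normc w in h *; set s := normc z in h *.
move=> u0 v0 s0; apply: (@le_trans _ _ ((v + u) ^+ 2)).
  by rewrite ler_sqr ?nnegrE// addr_ge0.
rewrite -subr_ge0 (_ : _ - _ = (eta * v - u) ^+ 2 / eta).
  by rewrite divr_ge0 ?sqr_ge0// ltW.
by field; rewrite gt_eqF.
Qed.

Lemma integral_normc2_split d (F G : d.-tuple (measurableTypeR R) -> R[i]) (eta : R) :
  cmeasurable F -> cmeasurable G -> 0 < eta ->
  (\int[unit_cube_measure d]_x (normc (G x) ^+ 2)%:E <=
   (1 + eta)%:E * (\int[unit_cube_measure d]_x (normc (F x) ^+ 2)%:E) +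
   (1 + eta^-1)%:E * (\int[unit_cube_measure d]_x (normc (F x - G x) ^+ 2)%:E))%E.
Proof.
move=> mF mG e0.
have i0 : 0 <= eta^-1 by rewrite invr_ge0 ltW.
have mFE := measurable_normcXE 2 mF.
have mFG := measurable_normcXE 2 (cmeasurableB mF mG).
have s0 (z : R[i]) : (0 <= (normc z ^+ 2)%:E)%E by rewrite lee_fin sqr_ge0.
rewrite -!ge0_integralZl//; [|by rewrite lee_fin addr_ge0// ltW..].
rewrite -ge0_integralD//; last first.
- exact: measurable_funeM.
- by move=> x _; rewrite mule_ge0// lee_fin addr_ge0.
- exact: measurable_funeM.
- by move=> x _; rewrite mule_ge0// lee_fin addr_ge0// ltW.
apply: ge0_le_integral => //.
- exact: measurable_normcXE.
- by apply: emeasurable_funD; exact: measurable_funeM.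
- by move=> x _; rewrite -!EFinM -EFinD lee_fin normc_sq_split.
Qed.

(** Bessel's inequality. One partial sum and eta = 1 show that K is finite; small eta then bounds
    every energy by K. *)
Lemma expsum_energy d a (F : d.-tuple (measurableTypeR R) -> R[i]) :
  (0 < d)%N -> is_expsum a F ->
  exists K : R, (\int[unit_cube_measure d]_x (normc (F x) ^+ 2)%:E = K%:E)%E /\
    forall N, energy a N <= K.
Proof.
move=> d0 /is_expsumP[mF cF].
have [K IK] : exists K : R, (\int[unit_cube_measure d]_x (normc (F x) ^+ 2)%:E = K%:E)%E.
  have [N /(_ N (leqnn N)) HN] := cF 1 ltr01.
  suff h : (\int[unit_cube_measure d]_x (normc (F x) ^+ 2)%:E < +oo)%E.
    exists (fine (\int[unit_cube_measure d]_x (normc (F x) ^+ 2)%:E)%E).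
    rewrite fineK// ge0_fin_numE//.
    by apply: integral_ge0 => x _; rewrite lee_fin sqr_ge0.
  have mf := @cmeasurable_expsum_partial d a N.
  have := integral_normc2_split mf mF ltr01; move/le_lt_trans; apply.
  rewrite integral_normc2_expsum//.
  under [X in (_ + _ * X)%E]eq_integral do rewrite -opprB normcN.
  rewrite -EFinM lte_add_pinfty ?ltry//.
  rewrite (le_lt_trans (lee_wpmul2l _ HN))// ?lee_fin ?addr_ge0 ?invr_ge0//.
  by rewrite -EFinM ltry.
exists K; split=> // N.
have K0 : 0 <= K.
  by rewrite -lee_fin -IK; apply: integral_ge0 => x _; rewrite lee_fin sqr_ge0.
have main eta : 0 < eta -> energy a N <= (1 + eta) * K + eta.
  move=> e0; have i0 : 0 < 1 + eta^-1 by rewrite addr_gt0// invr_gt0.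
  (* This accuracy cancels the factor 1 + 1/eta, so the error term is at most eta. *)
  have [|M HM] := cF (eta / (1 + eta^-1)); first by rewrite divr_gt0.
  have {HM} := HM (maxn M N) (leq_maxl _ _) => HM.
  apply: (le_trans (le_energy a (leq_maxr M N))).
  have := integral_normc2_split mF (@cmeasurable_expsum_partial d a (maxn M N)) e0.
  rewrite integral_normc2_expsum// IK => h; rewrite -lee_fin.
  apply: (le_trans h); rewrite [leRHS]EFinD [X in (_ <= X + _)%E]EFinM leeD2l//.
  have h2 : (0 <= (1 + eta^-1)%:E)%E by rewrite lee_fin ltW.
  apply: (le_trans (lee_wpmul2l h2 HM)).
  by rewrite -EFinM lee_fin mulrCA divff ?mulr1// gt_eqF.
rewrite leNgt; apply/negP => KN.
(* For this eta, (1 + eta) K + eta = K + eta (K + 1) lies halfway between K and the energy, a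
   contradiction. *)
have c0 : 0 < (energy a N - K) / (2 * (K + 1)).
  by rewrite divr_gt0 ?subr_gt0// mulr_gt0// ltr_wpDl.
have := main _ c0; set eta := _ / _.
have : eta * (K + 1) = (energy a N - K) / 2.
  by rewrite /eta; field; rewrite gt_eqF// ltr_wpDl.
by lra.
Qed.

Lemma expsum_2d_bound d a (F : d.-tuple (measurableTypeR R) -> R[i]) (K : R) :
  is_expsum a F -> (forall N, energy a N <= K) ->
  (\int[unit_cube_measure d]_x (normc (F x) ^+ (2 * d))%:E <= (d`!%:R * K ^+ d)%:E)%E.
Proof.
move=> /is_expsumP[mF cF] aK.
apply: (@fatou_L2 _ _ _ _ (fun k x => expsum_partial a k x)) => //.
  by move=> k; exact: cmeasurable_expsum_partial.
move=> k; apply: (le_trans (integral_normc2d_expsum d a k)).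
rewrite lee_fin ler_wpM2l// lerXn2r ?nnegrE ?energy_ge0//.
exact: le_trans (energy_ge0 a 0) (aK 0).
Qed.

Lemma integral_normc2_expsumB d a M N : (0 < d)%N -> (M <= N)%N ->
  (\int[unit_cube_measure d]_x
     (normc (expsum_partial a N x - expsum_partial a M x) ^+ 2)%:E
   = (energy a N - energy a M)%:E)%E.
Proof.
move=> d0 MN; under eq_integral do rewrite expsum_partialB//.
by rewrite integral_normc2_expsum// energyB.
Qed.

(** The limsup is measurable on the whole space and equals the limit wherever there is one; [fine]
    only alters values off the convergence set. *)
Lemma measurable_ae_lim dd (T : measurableType dd) (P : probability T R)
    (v : nat -> T -> R) :
  (forall k, measurable_fun setT (v k)) -> {ae P, forall x, cvgn (v ^~ x)} ->
  exists h : T -> R, measurable_fun setT h /\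
    {ae P, forall x, v ^~ x @ \oo --> h x}.
Proof.
move=> mv cv; exists (fun x => fine (limn_esup (fun k => (v k x)%:E))); split.
  apply: measurableT_comp => //; apply: measurable_fun_limn_esup => k.
  exact/measurable_EFinP.
apply: filterS cv => x /cvg_ex[l vl].
have vE : (fun k => (v k x)%:E) @ \oo --> l%:E.
  by apply: cvg_EFin => //; exact: nearW.
by have [_ ->] := cvg_limn_einf_sup vE.
Qed.

Lemma cvgn_summable_increments (w : nat -> R) (u : nat -> R) :
  (forall k, `|w k.+1 - w k| <= u k) -> cvgn (series u) -> cvgn w.
Proof.
move=> wu cu; have : cvgn (series (telescope w)).
  apply: normed_cvg; apply: (series_le_cvg _ _ _ cu) => [k|k|k]//=.
    exact: le_trans (wu k).
  exact: wu.
move=> /cvg_ex[l wl]; apply/cvg_ex; exists (w 0 + l).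
have H : (fun n => w 0 + series (telescope w) n) @ \oo --> w 0 + l.
  by apply: cvgD => //; exact: cvg_cst.
rewrite (_ : (fun n => _) = w) in H => //.
by apply/funext => n; rewrite -eq_sum_telescope.
Qed.

Lemma normc_sq (z : R[i]) : normc z ^+ 2 = complex.Re z ^+ 2 + complex.Im z ^+ 2.
Proof. by case: z => x y; rewrite /normc sqr_sqrtr ?addr_ge0 ?sqr_ge0. Qed.

Lemma ler_Re_normc (z : R[i]) : `|complex.Re z| <= normc z.
Proof.
by rewrite -ler_sqr ?nnegrE ?normc_ge0// real_normK ?num_real// normc_sq lerDl sqr_ge0.
Qed.

Lemma ler_Im_normc (z : R[i]) : `|complex.Im z| <= normc z.
Proof.
by rewrite -ler_sqr ?nnegrE ?normc_ge0// real_normK ?num_real// normc_sq lerDr sqr_ge0.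
Qed.

(** Riesz-Fischer: along sparse indices the increments have summable L^1 norms, so real and
    imaginary parts converge almost everywhere. Fatou then shows that the pointwise limit is the L^2
    limit of the full sequence. *)
Lemma expsum_exists d a : (0 < d)%N ->
  (forall eps : R, 0 < eps -> exists N, forall m n, (N <= m)%N -> (m <= n)%N ->
     energy a n - energy a m <= eps) ->
  exists F : d.-tuple (measurableTypeR R) -> R[i], is_expsum a F.
Proof.
move=> d0 cau.
have dl0 k : 0 < 1 / (2 ^ k.+1)%:R :> R by rewrite divr_gt0// ltr0n expn_gt0.
(* The threshold is squared because the L^1 norm of an increment is bounded by its L^2 norm, the
   square root of an energy difference. *)
have /choice[n0 Hn0] (k : nat) : exists N, forall m n, (N <= m)%N -> (m <= n)%N ->
    energy a n - energy a m <= (1 / (2 ^ k.+1)%:R) ^+ 2.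
  by apply: cau; rewrite exprn_gt0.
(* Summing the thresholds makes N monotone. *)
pose N k := (\sum_(i < k.+1) n0 i + k)%N.
have nN k : (n0 k <= N k)%N by rewrite /N big_ord_recr/=; lia.
have kN k : (k <= N k)%N by rewrite /N leq_addl.
have NS k : (N k <= N k.+1)%N by rewrite /N [in leqRHS]big_ord_recr/=; lia.
pose f k (x : d.-tuple (measurableTypeR R)) := expsum_partial a (N k) x.
have mf k : cmeasurable (f k) by exact: cmeasurable_expsum_partial.
pose u k x := normc (f k.+1 x - f k x).
have mu k : measurable_fun setT (u k).
  by have [? ?] := cmeasurableB (mf k.+1) (mf k); exact: measurable_normc.
have u0 k x : 0 <= u k x by exact: normc_ge0.
have ub k : (\int[unit_cube_measure d]_x (u k x)%:E <= (1 / (2 ^ k.+1)%:R)%:E)%E.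
  have := le_Lnorm (unit_cube_measure d) (mu k) ltr01 (ler1n R 2).
  rewrite (@Lnorm_ge0_natE _ _ _ _ 2)// Lnorm1.
  under eq_integral do rewrite abse_EFin ger0_norm//.
  move=> /le_trans; apply.
  rewrite integral_normc2_expsumB// poweR_EFin lee_fin.
  rewrite powR12_sqrt; last by rewrite subr_ge0 le_energy.
  rewrite -[leRHS]ger0_norm; last exact/ltW.
  by rewrite -sqrtr_sqr ler_wsqrtr// Hn0.
have cu := ae_cvg_series mu u0 ub.
have [hr [mhr chr]] : exists h, measurable_fun setT h /\
    {ae unit_cube_measure d, forall x, (fun k => complex.Re (f k x)) @ \oo --> (h x : R)}.
  apply: measurable_ae_lim => [k|]; first by case: (mf k).
  apply: filterS cu => x; apply: cvgn_summable_increments => k.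
  by rewrite -raddfB; exact: ler_Re_normc.
have [hi [mhi chi]] : exists h, measurable_fun setT h /\
    {ae unit_cube_measure d, forall x, (fun k => complex.Im (f k x)) @ \oo --> (h x : R)}.
  apply: measurable_ae_lim => [k|]; first by case: (mf k).
  apply: filterS cu => x; apply: cvgn_summable_increments => k.
  by rewrite -raddfB; exact: ler_Im_normc.
exists (fun x => (hr x +i* hi x)%C); apply/is_expsumP.
have mF : cmeasurable (fun x => (hr x +i* hi x)%C) by split.
split=> // eps e0; have [M HM] := cau _ e0; exists M => k Mk.
have mfk := @cmeasurable_expsum_partial d a k.
(* Here k is fixed and j tends to infinity. The shift j + k ensures [N (j + k)] is at least k, so
   each integral is an energy increment beyond M. *)
apply: (@fatou_ae _ _ _ _ (fun j x => normc (f (j + k)%N x - expsum_partial a k x) ^+ 2)).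
- by move=> j; apply: measurable_normcX; exact: cmeasurableB.
- by apply: measurable_normcX; exact: cmeasurableB.
- by move=> j x; exact: sqr_ge0.
- by move=> x; exact: sqr_ge0.
- move=> j; have kNj : (k <= N (j + k))%N by rewrite (leq_trans _ (kN _))// leq_addl.
  by rewrite integral_normc2_expsumB// lee_fin HM.
apply: filterS2 chr chi => x cr ci.
under eq_fun do rewrite normc_sq !raddfB/=.
rewrite normc_sq !raddfB/=.
have shift (w : nat -> R) (l c : R) : w @ \oo --> l ->
    (fun j => (w (j + k)%N - c) ^+ 2) @ \oo --> (l - c) ^+ 2.
  move=> wl; have wc : (fun j => w (j + k)%N - c) @ \oo --> l - c.
    by apply: cvgB; [rewrite (@cvg_shiftn k _ w)|exact: cvg_cst].
  exact: (continuous_cvg _ (@exprn_continuous R 2 _) wc).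
exact: (cvgD (shift _ _ (complex.Re (expsum_partial a k x)) cr)
  (shift _ _ (complex.Im (expsum_partial a k x)) ci)).
Qed.

End main.

Theorem mainTheorem4 (R : realType) (d : nat) (hd : (2 <= d)%N)
    (a A : int -> R) (haA : forall n : int, `|a n| <= A n)
    (p : R) (hp2 : 2 <= p) (hp2d : p <= (2 * d)%:R)
    (G : d.-tuple (measurableTypeR R) -> R[i]) (hG : is_expsum A G) :
  (exists F : d.-tuple (measurableTypeR R) -> R[i], is_expsum a F) /\
  (forall F : d.-tuple (measurableTypeR R) -> R[i], is_expsum a F ->
     (Lnorm_cube p F <=
        (((d`!)%:R : R) `^ ((2 * d)%:R)^-1)%:E * Lnorm_cube p G)%E).
Proof.
have d0 : (0 < d)%N by exact: leq_trans hd.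
have [K [GK AK]] := expsum_energy d0 hG.
split.
  (* The energies of A increase and are bounded by K, hence are Cauchy; those of a have smaller
     increments. *)
  apply: expsum_exists => // eps e0.
  have nd : nondecreasing_seq (energy A) by move=> m n; exact: le_energy.
  have cA : cvgn (energy A).
    by apply: nondecreasing_is_cvgn => //; exists K => _ [n _ <-].
  have /cvgrPdist_le /(_ _ e0)[N _ HN] := cA.
  exists N => m n Nm mn; apply: (le_trans (energyB_le mn haA)).
  have := HN m Nm; rewrite /= ler_norml => /andP[_]; apply: le_trans.
  by rewrite lerD2r nondecreasing_cvgn_le.
move=> F hF.
have mF : measurable_fun setT (fun x => normc (F x)).
  by case: hF => ? ? _; exact: measurable_normc.
have mG : measurable_fun setT (fun x => normc (G x)).
  by case: hG => ? ? _; exact: measurable_normc.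
have aK N : energy a N <= K := le_trans (energy_le N haA) (AK N).
have K0 : 0 <= K := le_trans (energy_ge0 A 0) (AK 0).
have p0 : 0 < p by apply: lt_le_trans hp2.
apply: (le_trans (le_Lnorm (unit_cube_measure d) mF p0 hp2d)).
have GE : (Lnorm_cube 2 G = (K `^ 2^-1)%:E)%E.
  by rewrite /Lnorm_cube (@Lnorm_ge0_natE _ _ _ _ 2)// ?GK// => x; exact: normc_ge0.
have GN : ((K `^ 2^-1)%:E <= Lnorm_cube p G)%E.
  by rewrite -GE; exact: (le_Lnorm (unit_cube_measure d) mG).
apply: (@le_trans _ _
  ((((d`!)%:R : R) `^ ((2 * d)%:R)^-1)%:E * (K `^ 2^-1)%:E)%E); last first.
  by rewrite lee_wpmul2l// lee_fin powR_ge0.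
rewrite Lnorm_ge0_natE; last by move=> x; exact: normc_ge0.
have dd0 : 0 < (2 * d)%:R^-1 :> R by rewrite invr_gt0 ltr0n muln_gt0.
apply: (@le_trans _ _ ((d`!%:R * K ^+ d)%:E `^ (2 * d)%:R^-1)%E).
  rewrite (le_poweR_iff dd0) ?(expsum_2d_bound hF aK)//.
  - by apply: integral_ge0 => x _; rewrite lee_fin exprn_ge0// normc_ge0.
  - by rewrite lee_fin mulr_ge0// exprn_ge0.
(* The exponents combine as d / (2d) = 1/2, which turns K^d into the L^2 norm of G. *)
rewrite poweR_EFin -EFinM lee_fin powRM ?exprn_ge0//.
rewrite -[K ^+ d]powR_mulrn// -powRrM natrM invfM mulrCA divff ?mulr1//.
by rewrite pnatr_eq0 -lt0n.
Qed.
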